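(* Let $C\subseteq\mathbb{R}^n$ be a nonempty closed convex set, let $A\in\mathbb{R}^{n\times n}$ be symmetric, $B\in\mathbb{R}^{n\times m}$ and $a\in\mathbb{R}^n$. Suppose that $A=A_1-A_2$, where $A_1$ is a symmetric positive definite matrix and $A_2$ is a symmetric matrix, and that $U$, $V$ are two real matrices of appropriate sizes (with $n$ and $m$ columns respectively, and the same number of rows) satisfying $U^TV=B$ and such that $A_2+\frac12U^TU$ is positive semidefinite. Let $G=2A_1$ and let $g:\mathbb{R}^n\times\mathbb{R}^m\to\mathbb{R}$ be the regularized gap function $$g(x,y)=\max_{v\in C}\Big\{(x-v)^T(Ax+By+a)-\tfrac12(v-x)^TG(v-x)\Big\}.$$ Then for all $(x,y)\in\mathbb{R}^n\times\mathbb{R}^m$, $$g(x,y)=g_1(x,y)-h_1(x,y),$$ where $$g_1(x,y)=\tfrac12\|Ux+Vy\|^2+a^Tx+\max_{v\in C}\Big\{[(A_1+A_2)x-By-a]^Tv-v^TA_1v\Big\},$$ $$h_1(x,y)=\tfrac12x^T(2A_2+U^TU)x+\tfrac12\|Vy\|^2,$$ and both $g_1$ and $h_1$ are differentiable convex functions on $\mathbb{R}^n\times\mathbb{R}^m$.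
   Context: $\|\cdot\|$ is the Euclidean norm. All maxima over $C$ above are maxima of strongly concave quadratic functions of $v$ over a nonempty closed convex set, hence attained at a unique point. *)

(* Defs.v *)
From HB Require Import structures.
From mathcomp Require Export all_boot all_order all_algebra.
From mathcomp Require Export all_classical all_reals all_analysis.

Set Implicit Arguments.
Unset Strict Implicit.
Unset Printing Implicit Defensive.

Import Order.TTheory GRing.Theory Num.Theory.
Import numFieldNormedType.Exports.

Local Open Scope classical_set_scope.
Local Open Scope ring_scope.

Definition dotv {R : realType} {k : nat} (x y : 'cV[R]_k) : R :=
  (x^T *m y) 0 0.

(* The library norm `|x| on matrices is the sup norm, hence a separate
   Euclidean norm. The two induce the same topology, so closedness and
   (Frechet) differentiability may be taken from the library. *)
Definition enorm {R : realType} {k : nat} (x : 'cV[R]_k) : R :=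
  Num.sqrt (dotv x x).

Definition posdefmx {R : realType} {k : nat} (M : 'M[R]_k) : Prop :=
  M \is symmetricmx /\ forall x : 'cV[R]_k, x != 0 -> 0 < dotv x (M *m x).

Definition possemidefmx {R : realType} {k : nat} (M : 'M[R]_k) : Prop :=
  M \is symmetricmx /\ forall x : 'cV[R]_k, 0 <= dotv x (M *m x).

(* The greatest element of S: an upper bound of S that belongs to S.
   A supremum that is not attained does not count; the value is 0 if S has no
   greatest element. *)
Definition maximum {R : realType} (S : set R) : R := xget 0 (S `&` ubound S).

Lemma maximumE {R : realType} (S : set R) (M : R) :
  S M -> ubound S M -> maximum S = M.
Proof.
move=> SM uM; rewrite /maximum; case: xgetP => [N _ [SN uN]|/(_ M)[]//].
by apply/eqP; rewrite eq_le uM//= uN.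
Qed.

(* The regularized gap function, for a general matrix G. *)
Definition gap {R : realType} {n m : nat} (C : set 'cV[R]_n)
    (A : 'M[R]_n) (B : 'M[R]_(n, m)) (a : 'cV[R]_n) (G : 'M[R]_n)
    (x : 'cV[R]_n) (y : 'cV[R]_m) : R :=
  maximum [set dotv (x - v) (A *m x + B *m y + a)
               - 2^-1 * dotv (v - x) (G *m (v - x)) | v in C].

Definition g1 {R : realType} {n m k : nat} (C : set 'cV[R]_n)
    (A1 A2 : 'M[R]_n) (B : 'M[R]_(n, m)) (a : 'cV[R]_n)
    (U : 'M[R]_(k, n)) (V : 'M[R]_(k, m))
    (x : 'cV[R]_n) (y : 'cV[R]_m) : R :=
  2^-1 * enorm (U *m x + V *m y) ^+ 2 + dotv a x
  + maximum [set dotv ((A1 + A2) *m x - B *m y - a) v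
                 - dotv v (A1 *m v) | v in C].

Definition h1 {R : realType} {n m k : nat} (A2 : 'M[R]_n)
    (U : 'M[R]_(k, n)) (V : 'M[R]_(k, m))
    (x : 'cV[R]_n) (y : 'cV[R]_m) : R :=
  2^-1 * dotv x ((2 *: A2 + U^T *m U) *m x) + 2^-1 * enorm (V *m y) ^+ 2.

(* Differentiable (everywhere) and convex on the product space, for a function
   of two variables; the codomain R^o is R seen as a normed module over R. *)
Definition differentiable_convex {R : realType} {n m : nat}
    (f : 'cV[R]_n -> 'cV[R]_m -> R) : Prop :=
  let F : 'cV[R]_n * 'cV[R]_m -> R^o := fun p => f p.1 p.2 in
  (forall p, differentiable F p) /\ convex_function setT F.

(* Main.v *)
From HB Require Import structures.
Require Import Defs.
From mathcomp Require Import ring lra.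
Import Order.TTheory GRing.Theory Num.Theory.
Import numFieldNormedType.Exports.
Local Open Scope classical_set_scope.
Local Open Scope ring_scope.

(* The formula follows by expanding the quadratic under the maximum: with
   U^T V = B it is, up to terms independent of v, the objective of g1.
   For convexity and differentiability, call f smooth convex if for every p it
   lies between its tangent at p and that tangent plus K |h|^2, for some K.
   Positive semidefinite quadratic forms have this property, and so does
     w |-> max_{v in C} (w.v - v.A1 v),
   whose gradient at w is the maximizer v: the lower bound holds since v is a
   competitor at w + h; the upper bound since the objective at w decreases
   quadratically away from v, so that the excess is at most
   max_d (h.d - d.A1 d) = h.A1^-1 h / 4. *)

(** * Sup-norm estimates and compactness for matrices and column vectors *)

Section Norms.
Context {R : realType}.

Lemma ler_norm_entry {m n : nat} (M : 'M[R]_(m, n)) i j : `|M i j| <= `|M|.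
Proof.
rewrite [leRHS]/Num.Def.normr/= mx_normrE.
exact: (le_bigmax _ (fun ij => `|M ij.1 ij.2|) (i, j)).
Qed.

Lemma mx_norm_le {m n : nat} (M : 'M[R]_(m, n)) (c : R) :
  0 <= c -> (forall i j, `|M i j| <= c) -> `|M| <= c.
Proof.
move=> c0 Mc; rewrite [leLHS]/Num.Def.normr/= mx_normrE.
by apply: bigmax_le => // -[i j] _; exact: Mc.
Qed.

Lemma norm_trmx {m n : nat} (M : 'M[R]_(m, n)) : `|M^T| = `|M|.
Proof.
apply/le_anti/andP; split; apply: mx_norm_le => // i j.
  by rewrite mxE ler_norm_entry.
by have := ler_norm_entry M^T j i; rewrite mxE.
Qed.

Lemma ler_norm_mulmx {m n p : nat} (M : 'M[R]_(m, n)) (N : 'M[R]_(n, p)) :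
  `|M *m N| <= n%:R * `|M| * `|N|.
Proof.
apply: mx_norm_le => [|i j]; first by rewrite !mulr_ge0.
rewrite mxE (le_trans (ler_norm_sum _ _ _))//.
apply: (@le_trans _ _ (\sum_(k < n) `|M| * `|N|)).
  by apply: ler_sum => k _; rewrite normrM ler_pM// ler_norm_entry.
by rewrite sumr_const card_ord mulr_natl mulrnAl.
Qed.

Lemma mulmx_continuous {m n p : nat} (M : 'M[R]_(m, n)) :
  continuous (mulmx M : 'M[R]_(n, p) -> 'M[R]_(m, p)).
Proof.
apply/linear_bounded_continuous/linear_boundedP.
exists (n%:R * `|M|); split; first exact: num_real.
move=> r Mr N; apply: (le_trans (ler_norm_mulmx _ _)).
by rewrite ler_wpM2r// ltW.
Qed.

(** Transposition is an isometry for the sup norm, so Heine-Borel carries over from row vectors. *)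
Lemma bounded_closed_compact_cV {n : nat} (A : set 'cV[R]_n) :
  bounded_set A -> closed A -> compact A.
Proof.
have tr_cont : continuous (trmx : 'rV[R]_n -> 'cV[R]_n).
  apply/linear_bounded_continuous/linear_boundedP.
  exists 1; split; first exact: num_real.
  by move=> r r1 N; rewrite norm_trmx ler_peMl// ltW.
move=> [B [Breal AB]] Acl.
have -> : A = trmx @` (trmx @^-1` A).
  by apply/seteqP; split=> [x Ax|_ [x Ax <-]//]; exists x^T => /=; rewrite trmxK.
apply: continuous_compact; first exact: (continuous_subspaceT tr_cont).
apply: bounded_closed_compact.
  by exists B; split=> // r /AB Ar x /Ar /=; rewrite norm_trmx.
by apply: closed_comp Acl => x _; exact: tr_cont.
Qed.

End Norms.

(** * Bilinear algebra of the dot product *)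

Section Dot.
Context {R : realType}.

Lemma dotvC {n : nat} (x y : 'cV[R]_n) : dotv x y = dotv y x.
Proof.
rewrite /dotv -[in LHS](trmxK y) -trmx_mul mxE.
by congr (_ _ _).
Qed.

Lemma dotvDl {n : nat} (x y z : 'cV[R]_n) :
  dotv (x + y) z = dotv x z + dotv y z.
Proof. by rewrite /dotv linearD mulmxDl mxE. Qed.

Lemma dotvDr {n : nat} (x y z : 'cV[R]_n) :
  dotv z (x + y) = dotv z x + dotv z y.
Proof. by rewrite /dotv mulmxDr mxE. Qed.

Lemma dotvZl {n : nat} c (x y : 'cV[R]_n) : dotv (c *: x) y = c * dotv x y.
Proof. by rewrite /dotv linearZ -scalemxAl mxE. Qed.

Lemma dotvZr {n : nat} c (x y : 'cV[R]_n) : dotv x (c *: y) = c * dotv x y.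
Proof. by rewrite /dotv -scalemxAr mxE. Qed.

Lemma dotvNl {n : nat} (x y : 'cV[R]_n) : dotv (- x) y = - dotv x y.
Proof. by rewrite -scaleN1r dotvZl mulN1r. Qed.

Lemma dotvNr {n : nat} (x y : 'cV[R]_n) : dotv x (- y) = - dotv x y.
Proof. by rewrite -scaleN1r dotvZr mulN1r. Qed.

Lemma dotv_mulmx {m n : nat} (M : 'M[R]_(m, n)) x y :
  dotv x (M *m y) = dotv (M^T *m x) y.
Proof. by rewrite /dotv trmx_mul trmxK mulmxA. Qed.

Lemma dotv_ge0 {n : nat} (x : 'cV[R]_n) : 0 <= dotv x x.
Proof.
by rewrite /dotv mxE; apply: sumr_ge0 => i _; rewrite mxE -expr2 sqr_ge0.
Qed.

Lemma sqr_enorm {n : nat} (x : 'cV[R]_n) : enorm x ^+ 2 = dotv x x.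
Proof. exact/sqr_sqrtr/dotv_ge0. Qed.

Lemma ler_norm_dotv {n : nat} (x y : 'cV[R]_n) :
  `|dotv x y| <= n%:R * `|x| * `|y|.
Proof.
by rewrite -[in leRHS]norm_trmx (le_trans (ler_norm_entry _ _ _))// ler_norm_mulmx.
Qed.

(** The codomain [R^o] makes [dotv u] a linear map between normed modules, hence a candidate
    derivative. *)
Definition dotv_lin {n : nat} (u : 'cV[R]_n) : 'cV[R]_n -> R^o := dotv u.

Fact dotv_lin_is_linear {n : nat} (u : 'cV[R]_n) : linear (dotv_lin u).
Proof. by move=> c x y; rewrite /dotv_lin dotvDr dotvZr. Qed.

HB.instance Definition _ {n : nat} (u : 'cV[R]_n) :=
  GRing.isLinear.Build R 'cV[R]_n R^o _ (dotv_lin u) (dotv_lin_is_linear u).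

Lemma dotv_lin_continuous {n : nat} (u : 'cV[R]_n) : continuous (dotv_lin u).
Proof.
apply/linear_bounded_continuous/linear_boundedP.
exists (n%:R * `|u|); split; first exact: num_real.
move=> r ur x; apply: (le_trans (ler_norm_dotv _ _)).
by rewrite ler_wpM2r// ltW.
Qed.

Lemma symmetricmx_tr {n : nat} (M : 'M[R]_n) : M \is symmetricmx -> M^T = M.
Proof.
move=> /is_hermitianmxP; rewrite expr0 scale1r => {2}->.
by apply/matrixP => i j; rewrite !mxE.
Qed.

Lemma dotv_sym {n : nat} (M : 'M[R]_n) (x y : 'cV[R]_n) :
  M \is symmetricmx -> dotv x (M *m y) = dotv y (M *m x).
Proof. by move=> /symmetricmx_tr MT; rewrite dotv_mulmx MT dotvC. Qed.

End Dot.

(** * Calculus of functions squeezed between a tangent and a quadratic *)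

Section SmoothConvex.
Context {R : realType}.

(** The lower bound yields convexity, the upper one differentiability. [K] may depend on [p], while
    [h] is unrestricted in size. *)
Definition smooth_convex {E : normedModType R} (f : E -> R) :=
  forall p, exists l : {linear E -> R^o}, continuous l /\
  exists K : R, forall h, 0 <= f (p + h) - f p - l h <= K * `|h| ^+ 2.

Lemma smooth_convex_differentiable {E : normedModType R} (f : E -> R^o) p :
  smooth_convex f -> differentiable f p.
Proof.
move=> /(_ p)[l [lc [K fK]]].
(* [K] may be nonpositive; |K| + 1 is a positive bound to divide by. *)
have K0 : 0 < `|K| + 1 by rewrite ltr_wpDl.
have dE : f \o shift p = cst (f p) + l +o_ 0 id.
  apply/eqaddoP => _/posnumP[e].
  near=> h.
  rewrite /= !fctE /= [h + p]addrC opprD addrA.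
  have /andP[f0 fle] := fK h.
  rewrite ger0_norm// (le_trans fle)// expr2 mulrA ler_wpM2r//.
  apply: (@le_trans _ _ ((`|K| + 1) * `|h|)).
    by rewrite ler_wpM2r// (le_trans (ler_norm K))// lerDl.
  rewrite -ler_pdivlMl// ltW//.
by apply/diff_locallyP; rewrite (diff_unique lc dE).
Unshelve. all: by end_near. Qed.

Lemma smooth_convex_convex {E : normedModType R} (f : E -> R^o) :
  smooth_convex f -> convex_function setT f.
Proof.
move=> fs t x y _ _; pose s : R := t%:num; pose z : E := s *: x + (1 - s) *: y.
have [l [_ [K fK]]] := fs z.
have tangent (u : E) : f z + l u - l z <= f u.
  by have /andP[+ _] := fK (u - z); rewrite subrKC linearB /=; lra.
have lz : l z = s * l x + (1 - s) * l y.
  rewrite /z (linearD l); congr (_ + _); exact: linearZ.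
have s0 : 0 <= s by rewrite /s.
have s1 : 0 <= 1 - s by rewrite subr_ge0 /s.
(* With [c] and [d] standing for [l x] and [l y], weighting the two tangent inequalities by [s] and
   [1 - s] cancels the linear parts. *)
have combine (a b c d e : R) : e + c - (s * c + (1 - s) * d) <= a ->
    e + d - (s * c + (1 - s) * d) <= b -> e <= s * a + (1 - s) * b.
  by move=> /(ler_wpM2l s0) + /(ler_wpM2l s1); lra.
by apply: (combine _ _ (l x) (l y)); rewrite -lz; exact: tangent.
Qed.

Lemma smooth_convexD {E : normedModType R} (f g : E -> R) :
  smooth_convex f -> smooth_convex g -> smooth_convex (fun p => f p + g p).
Proof.
move=> fs gs p; have [l [lc [K fK]]] := fs p; have [l' [lc' [K' gK]]] := gs p.
exists (l \+ l'); split.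
  by move=> x; apply: cvgD; [exact: lc|exact: lc'].
exists (K + K') => h; have := fK h; have := gK h; rewrite mulrDl /=.
by move=> /andP[? ?] /andP[? ?]; lra.
Qed.

(** Chain rule: [l \o L] is the new derivative, and a Lipschitz constant [k] of [L] turns the
    quadratic bound into |K| k^2. *)
Lemma smooth_convex_affine {E F : normedModType R} (f : F -> R)
    (L : {linear E -> F}) (c : F) :
  continuous L -> smooth_convex f -> smooth_convex (fun p => f (L p + c)).
Proof.
move=> Lc fs p; have [l [lc [K fK]]] := fs (L p + c).
have [k k0 Lk] := linear_lipschitz Lc.
exists (l \o L); split.
  by move=> x; apply: continuous_comp; [exact: Lc|exact: lc].
exists (`|K| * k ^+ 2) => h; have := fK (L h).
rewrite linearD [L p + L h + c]addrAC => /andP[-> /= /le_trans]; apply.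
rewrite -mulrA -exprMn (le_trans (ler_wpM2r _ (ler_norm K)))//.
by rewrite ler_wpM2l// lerXn2r// nnegrE ?mulr_ge0// ltW.
Qed.

Lemma smooth_convex_gradient {n : nat} (f : 'cV[R]_n -> R) :
  (forall p, exists u, exists K : R, forall h,
     0 <= f (p + h) - f p - dotv u h <= K * `|h| ^+ 2) -> smooth_convex f.
Proof.
move=> fs p; have [u fK] := fs p.
by exists (dotv_lin u); split; first exact: dotv_lin_continuous.
Qed.

Lemma smooth_convex_dotv {n : nat} (a : 'cV[R]_n) : smooth_convex (dotv a).
Proof.
apply: smooth_convex_gradient => p; exists a, 0 => h.
by rewrite dotvDr mul0r; lra.
Qed.

(** The remainder after the linear term is exactly [dotv h (M *m h)]. *)
Lemma smooth_convex_quad {n : nat} (M : 'M[R]_n) :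
  possemidefmx M -> smooth_convex (fun x => dotv x (M *m x)).
Proof.
move=> [Msym M0]; apply: smooth_convex_gradient => p; exists (2 *: (M *m p)).
exists (n%:R * (n%:R * `|M|)) => h.
have -> : dotv (p + h) (M *m (p + h)) - dotv p (M *m p)
    - dotv (2 *: (M *m p)) h = dotv h (M *m h).
  rewrite mulmxDr !dotvDr !dotvDl dotvZl (dotvC (M *m p)).
  by rewrite (dotv_sym _ p h Msym); ring.
rewrite M0/= (le_trans (ler_norm _))// (le_trans (ler_norm_dotv _ _))//.
rewrite -!mulrA ler_wpM2l//.
have := ler_wpM2l (normr_ge0 h) (ler_norm_mulmx M h); lra.
Qed.

End SmoothConvex.

Lemma smooth_convex_differentiable_convex {R : realType} {n m : nat}
    (f : 'cV[R]_n -> 'cV[R]_m -> R) :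
  smooth_convex (fun p : 'cV[R]_n * 'cV[R]_m => f p.1 p.2) ->
  differentiable_convex f.
Proof.
move=> fs; split; last exact: smooth_convex_convex.
by move=> p; exact: smooth_convex_differentiable.
Qed.

(** Every term of [g1] and [h1] is such a pullback of a function of one vector. *)
Lemma smooth_convex_affine_pair {R : realType} {n m k : nat} (f : 'cV[R]_k -> R)
    (M : 'M[R]_(k, n)) (N : 'M[R]_(k, m)) (c : 'cV[R]_k) :
  smooth_convex f ->
  smooth_convex (fun p : 'cV[R]_n * 'cV[R]_m => f (M *m p.1 + N *m p.2 + c)).
Proof.
apply: (@smooth_convex_affine R _ _ _ ((mulmx M \o fst) \+ (mulmx N \o snd))).
move=> p; apply: cvgD.
  by apply: continuous_comp; [exact: cvg_fst|exact: mulmx_continuous].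
by apply: continuous_comp; [exact: cvg_snd|exact: mulmx_continuous].
Qed.

Lemma smooth_convexZ {R : realType} {E : normedModType R} (c : R) (f : E -> R) :
  0 <= c -> smooth_convex f -> smooth_convex (fun p => c * f p).
Proof.
move=> c0 fs p; have [l [lc [K fK]]] := fs p.
exists (c \*: l); split.
  move=> x; apply: (@continuous_comp _ _ _ l ( *:%R c)); first exact: lc.
  exact: scaler_continuous.
exists (c * K) => h; have /andP[f0 fle] := fK h.
have -> : c * f (p + h) - c * f p - (c \*: l) h = c * (f (p + h) - f p - l h).
  by rewrite !mulrBr.
by rewrite mulr_ge0//= -mulrA ler_wpM2l.
Qed.

Lemma eq_smooth_convex {R : realType} {E : normedModType R} (f g : E -> R) :
  f =1 g -> smooth_convex f -> smooth_convex g.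
Proof. by move=> /funext ->. Qed.

(** * Maximization of a strongly concave quadratic over a closed convex set *)

Definition quad_obj {R : realType} {n : nat} (M : 'M[R]_n)
    (w v : 'cV[R]_n) : R :=
  dotv w v - dotv v (M *m v).

(** This is the convex conjugate of v^T M v plus the indicator of [C]. *)
Definition quad_conj {R : realType} {n : nat} (C : set 'cV[R]_n) (M : 'M[R]_n)
    (w : 'cV[R]_n) : R :=
  maximum [set quad_obj M w v | v in C].

Section QuadraticConjugate.
Context {R : realType} {n : nat} {C : set 'cV[R]_n} {M : 'M[R]_n}.
Context (C_nonempty : C !=set0) (C_closed : closed C) (C_convex : convex_set C).
Context (M_posdef : posdefmx M).

Lemma posdefmx_possemidefmx : possemidefmx M.
Proof.
have [Msym M0] := M_posdef; split=> // x.
by have [->|/M0/ltW//] := eqVneq x 0; rewrite mulmx0 dotv_ge0.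
Qed.

Lemma posdefmx_unitmx : M \in unitmx.
Proof.
have [/symmetricmx_tr MT M0] := M_posdef.
rewrite -row_free_unit; apply: inj_row_free => v vM0.
apply/eqP/negP => /negP v0.
have /M0 : v^T != 0 by rewrite -(inj_eq trmx_inj) trmxK trmx0.
have -> : M *m v^T = 0 by rewrite -[M]MT -trmx_mul vM0 trmx0.
by rewrite /dotv mulmx0 mxE ltxx.
Qed.

(* Completing the square: [w = 2 M z] for some [z], and
   [0 <= (d - z)^T M (d - z)]. *)
Lemma quad_obj_bound :
  exists K, 0 <= K /\ forall w d, quad_obj M w d <= K * `|w| ^+ 2.
Proof.
have [Msym M0] := posdefmx_possemidefmx.
set N := 2^-1 *: invmx M.
have MN w : M *m (N *m w) = 2^-1 *: w.
  by rewrite /N -scalemxAl -scalemxAr mulKVmx// posdefmx_unitmx.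
exists (2^-1 * n%:R * (n%:R * `|N|)); split; first by rewrite !mulr_ge0.
move=> w d; apply: (@le_trans _ _ (2^-1 * dotv w (N *m w))).
  have := M0 (d - N *m w).
  rewrite mulmxBr MN !(dotvDl, dotvDr, dotvNl, dotvNr) !dotvZr.
  rewrite (dotv_sym _ (N *m w) d Msym) MN dotvZr /quad_obj.
  by rewrite (dotvC d w) (dotvC (N *m w) w); lra.
rewrite -!mulrA ler_wpM2l// (le_trans (ler_norm _))//.
rewrite (le_trans (ler_norm_dotv _ _))// -mulrA ler_wpM2l//.
have := ler_wpM2l (normr_ge0 w) (ler_norm_mulmx N w); lra.
Qed.

Lemma quad_obj_continuous w : continuous (quad_obj M w : 'cV[R]_n -> R^o).
Proof.
move=> v; apply: (@continuousB _ _ _ (dotv_lin w)).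
  exact: dotv_lin_continuous.
apply/differentiable_continuous/smooth_convex_differentiable.
exact/smooth_convex_quad/posdefmx_possemidefmx.
Qed.

(** The part of [C] where the objective is at least its value at [v0] is compact, so the extreme
    value theorem applies there. *)
Lemma quad_obj_attains_max w :
  exists2 v, C v & forall u, C u -> quad_obj M w u <= quad_obj M w v.
Proof.
have [v0 Cv0] := C_nonempty; have [K [K0 objK]] := quad_obj_bound.
pose S := C `&` [set v | quad_obj M w v0 <= quad_obj M w v].
have Scl : closed S.
  apply: closedI => //.
  apply: (@closed_comp _ _ (quad_obj M w) [set t : R | quad_obj M w v0 <= t]).
    by move=> v _; exact: quad_obj_continuous.
  exact: closed_ge.
have Sbd : bounded_set S.
  exists (K * (`|w| + 1) ^+ 2 - quad_obj M w v0); split; first exact: num_real.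
  move=> r /ltW le_r v [_ /= vS]; apply: le_trans le_r.
  (* Tilting [w] by [s] adds [dotv s v] to the objective, which stays below the global bound; [s] is
     then taken to be plus or minus a basis vector to bound each coordinate of [v]. *)
  have bound (s : 'cV[R]_n) : `|s| <= 1 ->
      dotv s v <= K * (`|w| + 1) ^+ 2 - quad_obj M w v0.
    move=> s1; have : quad_obj M (w + s) v <= K * (`|w| + 1) ^+ 2.
      apply: (le_trans (objK _ _)); rewrite ler_wpM2l// lerXn2r// ?nnegrE//.
      by rewrite (le_trans (ler_normD _ _))// lerD2l.
    by rewrite /quad_obj dotvDl; move: vS; rewrite /quad_obj; lra.
  apply: mx_norm_le => [|i j].
    by have := bound 0; rewrite normr0 /dotv trmx0 mul0mx mxE; exact.
  have dotv_delta : dotv (delta_mx i 0) v = v i j.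
    by rewrite (ord1 j) /dotv trmx_delta -rowE mxE.
  have delta1 : `|delta_mx i 0 : 'cV[R]_n| <= 1.
    apply: mx_norm_le => // k l; rewrite mxE.
    by case: andP; rewrite ?normr1 ?normr0.
  rewrite ler_norml lerNl -dotv_delta -dotvNl.
  by rewrite !bound// normrN.
have [v /set_mem[Cv vS] vmax] : exists2 v, v \in S &
    forall u, u \in S -> quad_obj M w u <= quad_obj M w v.
  apply: compact_EVT_max; first by exists v0; split => //=.
    exact: bounded_closed_compact_cV.
  exact/continuous_subspaceT/quad_obj_continuous.
exists v => // u Cu; have [uS|/ltW uS] := lerP (quad_obj M w v0) (quad_obj M w u).
  by apply: vmax; apply/mem_set.
exact: le_trans vS.
Qed.

Lemma quad_conjE {w v} :
  C v -> (forall u, C u -> quad_obj M w u <= quad_obj M w v) ->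
  quad_conj C M w = quad_obj M w v.
Proof.
by move=> Cv vmax; apply: maximumE => [|_ [u Cu <-]]; [exists v|exact: vmax].
Qed.

(** On the segment from [v] to [u] the objective is a quadratic polynomial; maximality makes its
    slope [b] at [v] nonpositive, leaving the curvature term. *)
Lemma quad_obj_quadratic_growth {w v u} : C v ->
  (forall u, C u -> quad_obj M w u <= quad_obj M w v) -> C u ->
  quad_obj M w u <= quad_obj M w v - dotv (u - v) (M *m (u - v)).
Proof.
move=> Cv vmax Cu; have := subrKC v u; move: (u - v) => d uE.
have [Msym M0] := posdefmx_possemidefmx.
set q := dotv d (M *m d); set b := dotv w d - 2 * dotv d (M *m v).
have objD (t : R) :
      quad_obj M w (v + t *: d) = quad_obj M w v + t * b - t ^+ 2 * q.
  rewrite /quad_obj /b /q mulmxDr -scalemxAr !(dotvDl, dotvDr, dotvZl, dotvZr).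
  by rewrite (dotv_sym _ v d Msym); ring.
have q0 : 0 <= q := M0 d.
(* Compare v with the points v + t d of C, then let t be small. *)
have bt (t : R) : 0 < t -> t <= 1 -> b <= t * q.
  move=> t0 t1; rewrite -(ler_pM2l t0) mulrA -expr2.
  have Ct : C (v + t *: d).
    have := C_convex u v (Itv01 (ltW t0) t1) (mem_set Cu) (mem_set Cv).
    move=> /set_mem; congr C; rewrite /conv/= /unstable.onem scalerBl scale1r.
    by rewrite -uE scalerDr addrAC subrKC.
  have := vmax _ Ct; rewrite objD; lra.
have b0 : b <= 0.
  rewrite leNgt; apply/negP => b0.
  have bq0 : 0 < b + q by rewrite ltr_wpDr.
  (* This [t] lies in (0, 1] when [b] is positive, and b <= t q then becomes b (b + q) <= b q,
     contradicting b^2 > 0. *)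
  have := bt (b / (b + q)); rewrite divr_gt0// ler_pdivrMr// mul1r lerDl.
  move=> /(_ isT q0); rewrite mulrAC ler_pdivlMr// mulrDr gerDr.
  by apply/negP; rewrite -ltNge mulr_gt0.
have := objD 1; rewrite scale1r uE; lra.
Qed.

Lemma smooth_convex_quad_conj : smooth_convex (quad_conj C M).
Proof.
have [K [K0 objK]] := quad_obj_bound.
apply: smooth_convex_gradient => w; have [v Cv vmax] := quad_obj_attains_max w.
exists v, K => h; have [u Cu umax] := quad_obj_attains_max (w + h).
(* Taking z = v gives the lower bound. For z = u, quadratic growth bounds the excess by
   [quad_obj M h (u - v)]. *)
have objD z : quad_obj M (w + h) z = quad_obj M w z + dotv v h + dotv h (z - v).
  by rewrite /quad_obj dotvDl !dotvDr dotvNr (dotvC v h); ring.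
rewrite (quad_conjE Cu umax) (quad_conjE Cv vmax); apply/andP; split.
  have := umax v Cv; rewrite !objD subrr.
  have -> : dotv h 0 = 0 by rewrite /dotv mulmx0 mxE.
  lra.
have := quad_obj_quadratic_growth Cv vmax Cu; have := objK h (u - v).
rewrite objD /quad_obj; lra.
Qed.

End QuadraticConjugate.

Theorem proposition2p1 (R : realType) (n m k : nat)
    (C : set 'cV[R]_n) (A A1 A2 : 'M[R]_n) (B : 'M[R]_(n, m)) (a : 'cV[R]_n)
    (U : 'M[R]_(k, n)) (V : 'M[R]_(k, m)) (G : 'M[R]_n)
    (C_nonempty : C !=set0) (C_closed : closed C) (C_convex : convex_set C)
    (A_sym : A \is symmetricmx)
    (A_split : A = A1 - A2)
    (A1_posdef : posdefmx A1)
    (A2_sym : A2 \is symmetricmx)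
    (UV_B : U^T *m V = B)
    (A2U_psd : possemidefmx (A2 + 2^-1 *: (U^T *m U)))
    (G_def : G = 2 *: A1) :
  (forall (x : 'cV[R]_n) (y : 'cV[R]_m),
     gap C A B a G x y = g1 C A1 A2 B a U V x y - h1 A2 U V x y) /\
  differentiable_convex (g1 C A1 A2 B a U V) /\
  differentiable_convex (h1 A2 U V).
Proof.
have A1_sym := A1_posdef.1.
have sqr_enorm_smooth p :
    smooth_convex (fun u : 'cV[R]_p => 2^-1 * enorm u ^+ 2).
  apply: smooth_convexZ => //.
  (* The squared norm is the quadratic form of the identity matrix. *)
  have -> : (fun u : 'cV[R]_p => enorm u ^+ 2) = fun u => dotv u (1%:M *m u).
    by apply/funext => u; rewrite mul1mx sqr_enorm.
  apply: smooth_convex_quad; split; last by move=> u; rewrite mul1mx dotv_ge0.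
  apply/is_hermitianmxP; rewrite expr0 scale1r trmx1.
  by apply/matrixP => i j; rewrite !mxE.
split; [|split].
- move=> x y.
  set w := (A1 + A2) *m x - B *m y - a.
  have [v Cv vmax] := quad_obj_attains_max C_nonempty C_closed A1_posdef w.
  rewrite /g1 -/w -/(quad_conj C A1 w) (quad_conjE Cv vmax) /quad_obj.
  (* The choice G = 2 A1 cancels x^T A1 x, and the first bracket is independent of [u], so both
     maxima share the maximizer [v]. *)
  have gapE u : dotv (x - u) (A *m x + B *m y + a)
      - 2^-1 * dotv (u - x) (G *m (u - x)) =
      (dotv x (B *m y) + dotv a x - dotv x (A2 *m x)) +
      (dotv w u - dotv u (A1 *m u)).
    rewrite A_split G_def /w -scalemxAl dotvZr mulrA mulVf// mul1r.
    rewrite !(mulmxBl, mulmxDl, mulmxBr, dotvDl, dotvDr, dotvNl, dotvNr).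
    rewrite (dotv_sym _ x u A1_sym) (dotvC x a) (dotvC (A1 *m x)).
    by rewrite (dotvC (A2 *m x)) (dotvC (B *m y)) (dotvC a u); ring.
  clearbody w.
  rewrite /gap (@maximumE _ _ (dotv x (B *m y) + dotv a x - dotv x (A2 *m x)
    + (dotv w v - dotv v (A1 *m v)))).
  (* Since B = U^T V, x^T B y is the cross term of half the squared norm of Ux + Vy; [h1] removes
     the two squares. *)
  + rewrite /h1 !sqr_enorm mulmxDl !dotvDr -scalemxAl dotvZr -UV_B -!mulmxA.
    rewrite !dotvDl !(dotv_mulmx U^T) !trmxK (dotvC (V *m y) (U *m x)).
    by field.
  + by exists v; rewrite ?gapE.
  + by move=> _ [u Cu <-]; rewrite gapE lerD2l; exact: vmax.
- apply: smooth_convex_differentiable_convex; rewrite /g1.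
  apply: smooth_convexD; first apply: smooth_convexD.
  + apply: eq_smooth_convex
      (smooth_convex_affine_pair _ U V 0 (sqr_enorm_smooth k)) => p.
    by rewrite addr0.
  + apply: eq_smooth_convex
      (smooth_convex_affine_pair _ 1%:M 0 0 (smooth_convex_dotv a)) => p.
    by rewrite mul1mx mul0mx !addr0.
  + apply: eq_smooth_convex (smooth_convex_affine_pair _ (A1 + A2) (- B) (- a)
      (smooth_convex_quad_conj C_nonempty C_closed C_convex A1_posdef)) => p.
    by rewrite mulNmx.
- apply: smooth_convex_differentiable_convex; rewrite /h1.
  apply: smooth_convexD.
  + apply: eq_smooth_convex
      (smooth_convex_affine_pair _ 1%:M 0 0 (smooth_convex_quad _ A2U_psd)) => p.
    (* The factor 1/2 moves into the matrix, giving A2 + U^T U / 2, the matrix assumed positive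
       semidefinite. *)
    rewrite mul1mx mul0mx !addr0 -dotvZr scalemxAl scalerDr scalerA mulVf//.
    by rewrite scale1r.
  + apply: eq_smooth_convex
      (smooth_convex_affine_pair _ 0 V 0 (sqr_enorm_smooth k)) => p.
    by rewrite mul0mx add0r addr0.
Qed.
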